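(* Let $\lambda<\kappa$ be infinite cardinals with $\lambda$ regular, and let $\mathcal{L}$ be the graph language (one binary relation symbol). If $2^{2^\lambda}>2^\kappa$, then there is an open subset of $\mathrm{Mod}^\kappa_{\mathcal{L}}$ (in the bounded topology) which is closed under isomorphism but is not of the form $\mathrm{Mod}^\kappa_\varphi$ for any $\mathcal{L}_{\kappa^+\kappa}$-sentence $\varphi$.
   Context: No assumption on $\kappa^{<\kappa}$ is made. $\mathrm{Mod}^\kappa_{\mathcal{L}}={}^{\kappa\times\kappa}2$ is the space of $\mathcal{L}$-structures with domain $\kappa$, with the bounded topology generated by the sets $N_s=\{x: s\subseteq x\}$ for $s:\alpha\times\alpha\to2$, $\alpha<\kappa$ (equivalently, transferred from the bounded topology of ${}^\kappa2$ via the Hessenberg pairing bijection). $\mathcal{L}_{\kappa^+\kappa}$ is the infinitary logic closed under negation, conjunctions of sets of $\le\kappa$ formulas having altogether $<\kappa$ free variables, and existential quantification over sets of $<\kappa$ variables. $\mathrm{Mod}^\kappa_\varphi$ is the set of structures in $\mathrm{Mod}^\kappa_{\mathcal{L}}$ satisfying $\varphi$. *)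

(* Defs.v *)
From HB Require Import structures.
From mathcomp Require Import all_boot all_order.
From mathcomp Require Import all_classical topology.

Set Implicit Arguments.
Unset Strict Implicit.
Unset Printing Implicit Defensive.

Local Open Scope classical_set_scope.
Local Open Scope card_scope.
Local Open Scope order_scope.

Definition card_lt (T U : Type) (A : set T) (B : set U) : Prop :=
  A #<= B /\ ~ (B #<= A).

Definition segment d (K : orderType d) (a : K) : set K := [set i | i < a].

(* A cardinal is an initial ordinal, represented by a well-ordered type all of
   whose proper initial segments have smaller cardinality.  The ordinals below
   it are its elements: [a : K] stands for the order type of [segment a]. *)
Definition is_cardinal d (K : orderType d) : Prop :=
  wochoice.well_order (<=%O : rel K) /\
  forall a : K, card_lt (segment a) [set: K].

Definition cofinal_in d (K : orderType d) (A : set K) : Prop :=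
  forall x : K, exists2 y, A y & x <= y.

(* For a cardinal: its cofinality is itself. *)
Definition is_regular d (K : orderType d) : Prop :=
  forall A : set K, cofinal_in A -> ~ card_lt A [set: K].

(* Structures for one binary relation symbol with domain K, i.e. the space
   {}^{K x K} 2. *)
Definition Mod d (K : orderType d) : Type := K -> K -> bool.

Section BoundedTopology.
Context d (K : orderType d).

Definition basic_open (a : K) (s : segment a -> segment a -> bool) :
  set (Mod K) := [set M | forall i j : segment a, M (val i) (val j) = s i j].

Definition basic_opens : set (set (Mod K)) :=
  [set N | exists a : K, exists s : segment a -> segment a -> bool,
     N = basic_open s].

HB.instance Definition _ := gen_eqMixin (Mod K).
HB.instance Definition _ := gen_choiceMixin (Mod K).
HB.instance Definition _ := @isSubBaseTopological.Build (Mod K)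
  (set (Mod K)) basic_opens id.

End BoundedTopology.

Definition isomorphic d (K : orderType d) (M N : Mod K) : Prop :=
  exists2 f : K -> K, bijective f & forall i j, N (f i) (f j) = M i j.

Definition iso_closed d (K : orderType d) (U : set (Mod K)) : Prop :=
  forall M N : Mod K, isomorphic M N -> U M -> U N.

(* Raw infinitary formulas in the language of one binary relation, with K-many
   variables, named by the elements of K; this is enough, as an
   L_{K^+ K}-formula has fewer than K free variables, so that bound variables
   can be renamed.  A set of at most K formulas is given as a family indexed by
   a subset A of K; the values of the family outside A are irrelevant. *)
Inductive form (K : Type) : Type :=
| FEq of K & K
| FRel of K & K
| FNot of form K
| FConj of set K & (K -> form K)
| FEx of set K & form K.

Fixpoint fv (K : Type) (phi : form K) : set K :=
  match phi with
  | FEq x y => [set x; y]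
  | FRel x y => [set x; y]
  | FNot psi => fv psi
  | FConj A F => \bigcup_(a in A) fv (F a)
  | FEx X psi => fv psi `\` X
  end.

(* The raw formulas belonging to L_{K^+ K}. *)
Fixpoint is_formula (K : Type) (phi : form K) : Prop :=
  match phi with
  | FEq _ _ => True
  | FRel _ _ => True
  | FNot psi => is_formula psi
  | FConj A F => (forall a, A a -> is_formula (F a)) /\
                 card_lt (\bigcup_(a in A) fv (F a)) [set: K]
  | FEx X psi => is_formula psi /\ card_lt X [set: K]
  end.

Definition is_sentence (K : Type) (phi : form K) : Prop :=
  is_formula phi /\ fv phi = set0.

Fixpoint sat d (K : orderType d) (M : Mod K) (v : K -> K) (phi : form K) :
    Prop :=
  match phi with
  | FEq x y => v x = v y
  | FRel x y => M (v x) (v y)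
  | FNot psi => ~ sat M v psi
  | FConj A F => forall a, A a -> sat M v (F a)
  | FEx X psi => exists2 w : K -> K,
      (forall x, ~ X x -> w x = v x) & sat M w psi
  end.

(* Intended for sentences, whose truth value does not depend on v. *)
Definition models d (K : orderType d) (phi : form K) : set (Mod K) :=
  [set M | forall v : K -> K, sat M v phi].

(* Main.v *)
Require Import Defs.
From HB Require Import structures.
From mathcomp Require Import all_boot all_order finmap zify.
From mathcomp Require Import all_classical topology.

(* There are at most 2^K sentences, since formulas are coded by subsets of K;
   so it suffices to find 2^(2^L) open isomorphism-closed classes. Given
   structures A_x (x a subset of L) and a notion of good part of A_x, let U_S be
   the class of structures embedding a good part of some A_x, x in S. U_S is
   open if good parts stay good after restriction to some bounded piece, and the
   U_S are distinct if no good part of A_x embeds into A_y for y <> x.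

   If cf K <= L, then K is a limit cardinal; put Theta = L^+ and W = L^{++},
   both below K. The vertices of A_x are the pairs (a, z) in W x Theta. A point
   a of cofinality Theta is joined to a cofinal ladder of type Theta below it,
   which forces an embedding of a good part to fix the first coordinate of
   (a, z) for almost all a. A family of subsets T_x of W with stationary
   differences is then recovered from any good part as follows: (a, _) and
   (b, z) with a < b are related according to whether T_x contains the least
   d > a among the points of b whose index in a fixed injection of b into Theta
   is at most z. For z large and a close to d, every d of cofinality Theta can
   be obtained so, and the answer does not depend on z.

   If cf K > L, every copy of a structure of size L is bounded, and no pieces
   arise: ladders of type omega on W = L, with (a, _) and (b, _) related
   according to b in T_x, suffice when L is uncountable, and a rigid pattern on
   the natural numbers when L is countable. *)

Set Implicit Arguments.
Unset Strict Implicit.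
Unset Printing Implicit Defensive.

Import Order.TTheory.

Local Open Scope classical_set_scope.
Local Open Scope card_scope.
Local Open Scope order_scope.

(** * Cardinal comparisons *)

Lemma card_le_fun T U (A : set T) (B : set U) (u0 : U) : A #<= B ->
  exists f : T -> U, (forall x, A x -> B (f x)) /\
    (forall x y, A x -> A y -> f x = f y -> x = y).
Proof.
move=> /card_leP[f].
pose g x :=
  if pselect (A x) is left Ax then val (f (SigSub (mem_set Ax))) else u0.
exists g; split=> [x Ax|x y Ax Ay]; rewrite /g.
  by case: pselect => // Ax'; exact: set_valP.
case: pselect => // Ax'; case: pselect => // Ay' /val_inj fxy.
have /(congr1 val)// : SigSub (mem_set Ax') = SigSub (mem_set Ay').
by apply: (@inj _ _ _ f) fxy; exact: mem_set.
Qed.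

(** Choice extracts the injection, so maps defined by cases or through a preimage can be given as
    relations. *)
Lemma card_le_rel T U (A : set T) (B : set U) (R : T -> U -> Prop) :
  (forall x, A x -> exists2 y, B y & R x y) ->
  (forall x x' y, A x -> A x' -> R x y -> R x' y -> x = x') -> A #<= B.
Proof.
move=> Rtot Rinj.
have /choice[f fP] (a : A) : exists b : B, R (val a) (val b).
  have [y By Ry] := Rtot _ (set_valP a).
  by exists (SigSub (mem_set By)).
apply/card_leP/injfunPex; exists f => // a a' _ _ eq_f; apply: val_inj.
by apply: Rinj (fP a) _; [exact: set_valP|exact: set_valP|rewrite eq_f].
Qed.

Lemma card_le_X T U T' U' (A : set T) (B : set U) (A' : set T') (B' : set U') :
  A #<= B -> A' #<= B' -> A `*` A' #<= B `*` B'.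
Proof.
have [->|/set0P[a Aa]] := eqVneq A set0; first by rewrite set0X.
have [->|/set0P[a' Aa']] := eqVneq A' set0; first by rewrite setX0.
move=> AB AB'.
have [b0 _] : B !=set0.
  apply/set0P; apply: contraTneq AB => ->.
  by rewrite card_le0; apply/set0P; exists a.
have [b0' _] : B' !=set0.
  apply/set0P; apply: contraTneq AB' => ->.
  by rewrite card_le0; apply/set0P; exists a'.
have [f [fB finj]] := card_le_fun b0 AB.
have [g [gB ginj]] := card_le_fun b0' AB'.
apply: (@card_le_rel _ _ _ _ (fun p q => q = (f p.1, g p.2)))
  => [[x y] [/= Ax Ay]|].
  by exists (f x, g y) => //; split=> /=; [exact: fB|exact: gB].
by move=> [x y] [x' y'] q [/= ? ?] [/= ? ?] -> [/finj -> // /ginj ->].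
Qed.

(** Hilbert's hotel along a sequence [g] in [A]: [x] goes to [g 0], [g n] to [g n.+1], and all other
    points stay. *)
Lemma card_setU1_le T (x : T) (A : set T) : infinite_set A -> x |` A #<= A.
Proof.
move=> /infiniteP/(card_le_fun x)[g [gA ginj]].
have {}ginj n m : g n = g m -> n = m by exact: ginj.
apply: (@card_le_rel _ _ _ _ (fun y z => [\/ y = x /\ z = g 0,
   y <> x /\ exists2 n, y = g n & z = g n.+1 |
   [/\ y <> x, forall n, y <> g n & z = y]])).
  move=> y xAy; have [->|nyx] := pselect (y = x).
    by exists (g 0); [exact: gA|constructor 1].
  have [[n yn]|ng] := pselect (exists n, y = g n).
    by exists (g n.+1); [exact: gA|constructor 2; split => //; exists n].
  exists y; first by case: xAy.
  by constructor 3; split => // n yn; apply: ng; exists n.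
move=> y y' z _ _ [[-> ->]|[_ [n -> ->]]|[_ ny ->]].
- by move=> [[]//|[_ [m _ /ginj]]//|[_ ny' e]]; case: (ny' _ (esym e)).
- move=> [[_ /ginj]//|[_ [m -> /ginj[->]]]//|[_ ny' e]].
  by case: (ny' _ (esym e)).
- by move=> [[_ /ny]//|[_ [m _ /ny]]//|[]].
Qed.

Lemma bigcup_card_le I T U (P : set I) (F : I -> set U) (A : set T) :
  A `*` A #<= A -> P #<= A -> (forall i, P i -> F i #<= A) ->
  \bigcup_(i in P) F i #<= A.
Proof.
have [->|/set0P[a Aa]] := eqVneq A set0.
  by move=> _; rewrite card_le0 => /eqP -> _; rewrite bigcup_set0.
move=> AA PA FA; apply: card_le_trans AA.
have [p [pA pinj]] := card_le_fun a PA.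
have /choice[f fP] i : exists f : U -> T, P i ->
    (forall x, F i x -> A (f x)) /\
    (forall x y, F i x -> F i y -> f x = f y -> x = y).
  have [Pi|nPi] := pselect (P i); last by exists (fun=> a).
  by have [f fP] := card_le_fun a (FA i Pi); exists f.
apply: (@card_le_rel _ _ _ _
    (fun x y => exists i, [/\ P i, F i x & y = (p i, f i x)])).
  move=> x [i Pi Fix]; exists (p i, f i x); last by exists i.
  by split=> /=; [exact: pA|exact: (fP i Pi).1].
move=> x x' y _ _ [i [Pi Fi ->]] [j [Pj Fj [/pinj eq_ij]]].
by have eij := eq_ij Pi Pj; subst j; exact: (fP i Pi).2.
Qed.

Lemma card_lt_trans_le T U V (A : set T) (B : set U) (C : set V) :
  card_lt A B -> B #<= C -> card_lt A C.
Proof.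
move=> [AB nBA] BC; split; first exact: card_le_trans AB BC.
by move=> CA; apply: nBA; exact: card_le_trans BC CA.
Qed.

Lemma card_le_lt_trans T U V (A : set T) (B : set U) (C : set V) :
  A #<= B -> card_lt B C -> card_lt A C.
Proof.
move=> AB [BC nCB]; split; first exact: card_le_trans AB BC.
by move=> CA; apply: nCB; exact: card_le_trans CA AB.
Qed.

(** * Well-founded recursion *)

Lemma wf_recursion T U (r : T -> T -> Prop) (u0 : U)
    (P : T -> set U -> U -> Prop) : well_founded r ->
  exists e : T -> U, forall v, let A := e @` [set u | r u v] in
    (exists y, P v A y) -> P v A (e v).
Proof.
move=> wfr.
(* [pick] returns a default on the empty set, so the recursion is total; [P] is promised only where
   it can be met. *)
have /choice[pick pickP] (Q : set U) : exists y, Q !=set0 -> Q y.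
  have [[y Qy]|nQ] := pselect (Q !=set0); last by exists u0.
  by exists y.
pose F v (rec : forall u, r u v -> U) : U :=
  pick [set y | P v [set z | exists u (h : r u v), rec u h = z] y].
pose e := Fix wfr (fun=> U) F.
have eE v : e v = pick [set y | P v (e @` [set u | r u v]) y].
  rewrite {1}/e Fix_eq => [|x f g fg].
    congr pick; apply/funext => y; congr (P v _ y).
    by apply/seteqP; split=> [z [u [h <-]]|z [u h <-]]; [exists u|exists u, h].
  have -> // : f = g.
  apply: functional_extensionality_dep => y.
  by apply: functional_extensionality_dep => p; exact: fg.
exists e => v A exP; rewrite (eE v).
exact: (pickP [set y | P v (e @` [set u | r u v]) y]).
Qed.

(* Recursion along [r] sends each element outside the image of its
   predecessors. *)
Lemma wf_card_le T U (D : set T) (r : T -> T -> Prop) (B : set U) :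
  well_founded r ->
  (forall u v, D u -> D v -> u <> v -> r u v \/ r v u) ->
  (forall v, D v -> ~ (B #<= [set u | D u /\ r u v])) ->
  D #<= B.
Proof.
move=> wfr rtot nB.
have [->|/set0P[v0 Dv0]] := eqVneq D set0; first exact: card_ge0.
have [y0 _] : B !=set0.
  by apply/set0P; apply: contra_not_neq (nB v0 Dv0) => ->.
pose r' u v := D u /\ r u v.
have wfr' : well_founded r'.
  by move=> v; elim: (wfr v) => w _ IH; constructor => u [_ /IH].
have [e eP] := wf_recursion y0 (fun _ A y => B y /\ ~ A y) wfr'.
have {}eP v : D v -> B (e v) /\ forall u, r' u v -> e u <> e v.
  move=> Dv; have [|Bv nv] := eP v; last first.
    by split => // u ruv euv; apply: nv; exists u.
  (* If no value is fresh, [e] attains every element of [B] on predecessors of [v], so [B] injects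
     into them. *)
  apply: contrapT => noy; apply: (nB v Dv).
  apply: (@card_le_rel _ _ _ _ (fun y u => e u = y)).
    by move=> y By; apply: contrapT => nou; apply: noy; exists y; split.
  by move=> x x' y _ _ -> ->.
apply: (@card_le_rel _ _ _ _ (fun v y => y = e v)).
  by move=> v Dv; exists (e v) => //; exact: (eP v Dv).1.
move=> u v _ Du Dv -> euv; apply: contrapT => /(rtot _ _ Du Dv)[ruv|rvu].
  exact: (eP v Dv).2 (conj Du ruv) euv.
exact: (eP u Du).2 (conj Dv rvu) (esym euv).
Qed.

Lemma wf_of_minimal T (r : T -> T -> Prop) :
  (forall P : set T, P !=set0 -> exists2 m, P m & forall x, P x -> ~ r x m) ->
  well_founded r.
Proof.
move=> rmin x; apply: contrapT => nx.
have [m nm mmin] := rmin [set y | ~ Acc r y] (ex_intro _ x nx).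
apply: nm; constructor => y rym; apply: contrapT => ny; exact: mmin y ny rym.
Qed.

(** * Well-orders and squares of infinite cardinals *)

Section WellOrder.
Context d (T : orderType d) (woT : wochoice.well_order (<=%O : rel T)).

Lemma wo_min (P : set T) : P !=set0 ->
  exists2 m, P m & forall x, P x -> (m <= x).
Proof.
move=> [x Px]; have [|m [[mP mmin] _]] := woT (A := [pred y | `[< P y >]]).
  by exists x; apply/asboolP.
exists m; first by move/asboolP: mP.
by move=> y Py; apply: mmin; apply/asboolP.
Qed.

Lemma wo_wf : well_founded (fun x y : T => (x < y)).
Proof.
apply: wf_of_minimal => P /wo_min[m Pm mmin]; exists m => // x /mmin.
by rewrite leNgt => /negP.
Qed.

(** Recursion into [C] can get stuck at [w] only if the values below [w] exhaust [C]. *)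
Lemma wo_card_le U (C : set U) :
  (forall w : T, ~ (C #<= segment w)) -> [set: T] #<= C.
Proof.
move=> nC; apply: (wf_card_le wo_wf) => [u v _ _ /eqP|w _].
  by rewrite neq_lt => /orP.
move=> Cw; apply: (nC w); apply: card_le_trans Cw _.
by apply: subset_card_le => u [].
Qed.

(** Inductive step of Hessenberg's theorem, for a downward closed [D] so as to cover both segments
    and the whole type. If [D] embeds in none of its segments, each pair has fewer than |D|
    predecessors in Goedel's order, and recursion embeds the square. *)
Lemma card_square_initial (D : set T) :
  (forall x y : T, x < y -> D y -> D x) ->
  infinite_set D ->
  (forall a, D a -> infinite_set (segment a) ->
     segment a `*` segment a #<= segment a) ->
  D `*` D #<= D.
Proof.
move=> Ddown infD IH.
have [[b [Db Db_le]]|nb] := pselect (exists b, D b /\ D #<= segment b).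
  have infb : infinite_set (segment b).
    by move=> finb; apply: infD; exact: card_le_finite Db_le finb.
  apply: card_le_trans (card_le_X Db_le Db_le) _.
  apply: card_le_trans (IH b Db infb) _.
  by apply: subset_card_le => x xb; exact: Ddown Db.
pose mx (p : T * T) := Order.max p.1 p.2.
(* Goedel's well-ordering of pairs. *)
pose r p q := (mx p < mx q) \/ mx p = mx q /\
  ((p.1 < q.1) \/ p.1 = q.1 /\ (p.2 < q.2)).
have wfr : well_founded r.
  apply: wf_of_minimal => P [p0 Pp0].
  have [|m [p1 Pp1 p1m] mmin] := wo_min (P := mx @` P).
    by exists (mx p0), p0.
  have [|a [p2 [Pp2 p2m] p2a] amin] :=
      wo_min (P := fst @` [set p | P p /\ mx p = m]).
    by exists p1.1, p1.
  have [|b [p3 [Pp3 p3m p3a] p3b] bmin] :=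
      wo_min (P := snd @` [set p | [/\ P p, mx p = m & p.1 = a]]).
    by exists p2.2, p2.
  exists p3 => // x Px [|[xm [|[xa]]]].
  - by rewrite p3m ltNge mmin//; exists x.
  - by rewrite p3a ltNge amin//; exists x => //; split => //; rewrite xm.
  - by rewrite p3b ltNge bmin//; exists x => //; split; rewrite ?xm ?xa.
apply: (wf_card_le wfr) => [[a b] [a' b'] _ _ nab|v [D1 D2] Dv].
  rewrite /r; have [lt|lt|eqm] := ltgtP (mx (a, b)) (mx (a', b')).
  - by left; left.
  - by right; left.
  have [lt|lt|eq1] := ltgtP a a'; first by left; right; split => //; left.
    by right; right; split => //; left.
  have [lt|lt|eq2] := ltgtP b b'; first by left; right; split => //; right.
    by right; right; split => //; right.
  by case: nab; rewrite eq1 eq2.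
(* Both coordinates of a predecessor of [v] are at most [m]; the square of [C] is no larger than the
   segment of [m], against [nb]. *)
pose m := mx v; pose C := m |` segment m.
have DC : D #<= C `*` C.
  apply: card_le_trans Dv _; apply: subset_card_le => u [_ ru].
  have : (mx u <= m) by case: ru => [/ltW//|[-> _]].
  rewrite /mx ge_max !le_eqVlt => /andP[/predU1P u1 /predU1P u2].
  by split; [case: u1; [left|right]|case: u2; [left|right]].
have Dm : D m by rewrite /m /mx; case: leP.
have infm : infinite_set (segment m).
  move=> finm; apply: infD; apply: card_le_finite DC _.
  by apply: finite_setX; rewrite finite_setU; split => //; exact: finite_set1.
apply: nb; exists m; split => //; apply: card_le_trans DC _.
by apply: card_le_trans (IH m Dm infm); apply: card_le_X; exact: card_setU1_le.
Qed.

Lemma card_square_segment (a : T) :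
  infinite_set (segment a) -> segment a `*` segment a #<= segment a.
Proof.
elim/(well_founded_ind wo_wf): a => a IH inf_a.
apply: card_square_initial => // x y; rewrite /segment /=.
exact: lt_trans.
Qed.

Lemma card_square : infinite_set [set: T] -> [set: T] `*` [set: T] #<= [set: T].
Proof.
move=> infT; apply: card_square_initial => // a _.
exact: card_square_segment.
Qed.

End WellOrder.

(** * Regular and successor cardinals *)

Lemma infinite_card_leU1 T U (x : T) (B : set T) (A : set U) :
  infinite_set A -> B #<= A -> x |` B #<= A.
Proof.
move=> infA BA; have [finB|infB] := pselect (finite_set B).
  apply: (@card_le_trans _ _ _ [set: nat]); last exact/infiniteP.
  by apply: finite_set_countable; rewrite finite_setU; split.
exact: card_le_trans (card_setU1_le _ infB) BA.
Qed.

Lemma cofinal_card_le d (T : orderType d) (C : set T) U (A : set U) :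
  infinite_set A -> A `*` A #<= A -> cofinal_in C -> C #<= A ->
  (forall c : T, segment c #<= A) -> [set: T] #<= A.
Proof.
move=> infA AA cofC CA segA.
apply: (card_le_trans _
  (@bigcup_card_le _ _ _ C (fun c => c |` segment c) A AA CA _)).
  apply: subset_card_le => x _; have [c Cc] := cofC x.
  by rewrite le_eqVlt => /predU1P[->|xc]; exists c => //; [left|right].
by move=> c _; exact: infinite_card_leU1.
Qed.

Definition regular_cardinal d (T : orderType d) : Prop :=
  [/\ is_cardinal T, infinite_set [set: T] & is_regular T].

Section RegularCardinal.
Context d (T : orderType d) (regT : regular_cardinal T).

Lemma reg_wo : wochoice.well_order (<=%O : rel T).
Proof. by case: regT => -[]. Qed.

Lemma reg_infinite : infinite_set [set: T].
Proof. by case: regT. Qed.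

Lemma reg_inhabited : exists x : T, True.
Proof. by have [x _] := infinite_setN0 reg_infinite; exists x. Qed.

Lemma reg_segment (a : T) : card_lt (segment a) [set: T].
Proof. by case: regT => -[]. Qed.

Lemma reg_bound I (A : set I) (f : I -> T) :
  card_lt A [set: T] -> exists b, forall i, A i -> f i < b.
Proof.
move=> ltA; case: regT => _ _ /(_ (f @` A)) regTA.
have ltfA : card_lt (f @` A) [set: T].
  exact: card_le_lt_trans (card_image_le _ _) ltA.
have /existsNP[b nb] : ~ cofinal_in (f @` A) by move=> /regTA.
exists b => i Ai; rewrite ltNge; apply/negP => bi.
by apply: nb; exists (f i) => //; exists i.
Qed.

Lemma reg_next (a : T) : exists b, a < b.
Proof.
have [|b /(_ a erefl)] := @reg_bound _ [set a] id; last by exists b.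
split; first exact: subset_card_le.
by move=> /card_le_finite/(_ (finite_set1 a)); exact: reg_infinite.
Qed.

End RegularCardinal.

Lemma regular_cardinal_nat : regular_cardinal nat.
Proof.
split; last 2 first.
- exact: infinite_nat.
- move=> A cofA [_]; apply; apply/infiniteP => finA.
  have [m /(_ _ _)mP] : exists m, forall x, A x -> x <= m.
    have [s sA] := (finite_seqP _).1 finA; exists (\max_(x <- s) x) => x.
    by rewrite sA /= leEnat => xs; exact: leq_bigmax_seq.
  have [y Ay] := cofA m.+1; rewrite leEnat => my.
  by have := mP _ Ay; rewrite leEnat leqNgt my.
split.
  apply: wochoice.antisymmetric_well_order => [x y|A [x xA]].
    by rewrite !leEnat -eqn_leq => /eqP.
  have exA : exists n, n \in A by exists x.
  by exists (ex_minn exA); case: ex_minnP => m mA mmin; split.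
move=> a; have -> : segment a = `I_a.
  by apply/seteqP; split=> x; rewrite /segment /= ltEnat.
split; first by apply: subset_card_le.
by move=> /card_le_finite /(_ (finite_II a)); exact: infinite_nat.
Qed.

Section Below.
Context d (K : orderType d) (a : K).

Definition below : Type := {i : K | i < a}.

HB.instance Definition _ := SubChoice.on below.
HB.instance Definition _ := [SubChoice_isSubOrder of below by <: with d].

Lemma card_below_le : [set: below] #<= segment a.
Proof.
apply: (@card_le_rel _ _ _ _ (fun i j => val i = j)) => [i _|i j _ _ _ <-].
  by exists (val i) => //; exact: (valP i).
by move/val_inj.
Qed.

Lemma card_below_ge : segment a #<= [set: below].
Proof.
apply: (@card_le_rel _ _ _ _ (fun i j => val j = i)) => [i ia|i j x _ _ <- //].
by exists (exist _ i ia).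
Qed.

Lemma card_segment_below (w : below) : segment w #<= segment (val w).
Proof.
apply: (@card_le_rel _ _ _ _ (fun i j => val i = j)) => [i iw|i j _ _ _ <-].
  by exists (val i).
by move/val_inj.
Qed.

Lemma wo_below : wochoice.well_order (<=%O : rel K) ->
  wochoice.well_order (<=%O : rel below).
Proof.
move=> woK; apply: wochoice.antisymmetric_well_order => [x y|A [x xA]].
  exact: le_anti.
have [|m [y yA <-] mmin] := wo_min woK (P := val @` [set y | y \in A]).
  by exists (val x), x.
by exists y; split => // z zA; apply: mmin; exists z.
Qed.

End Below.

(* [below a] is the cardinal successor of A. *)
Lemma successor_cardinal d (K : orderType d) U (A : set U) :
  wochoice.well_order (<=%O : rel K) -> infinite_set A -> A `*` A #<= A ->
  (exists a : K, ~ (segment a #<= A)) ->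
  exists a : K, [/\ regular_cardinal (below a), card_lt A [set: below a] &
    forall b, b < a -> segment b #<= A].
Proof.
move=> woK infA AA /(wo_min woK)[a naA amin]; exists a.
have segA b : b < a -> segment b #<= A.
  by move=> ba; apply: contrapT => /amin; rewrite leNgt ba.
have segwA (w : below a) : segment w #<= A.
  exact: card_le_trans (card_segment_below _) (segA _ (valP w)).
have nWA : ~ ([set: below a] #<= A).
  by move=> WA; apply: naA; exact: card_le_trans (card_below_ge _) WA.
have dich V (C : set V) : ~ (C #<= A) -> [set: below a] #<= C.
  move=> nCA; apply: (wo_card_le (wo_below woK)) => w Cw.
  by apply: nCA; exact: card_le_trans Cw (segwA w).
have AW : A #<= [set: below a].
  have [[w Aw]|nA] := pselect (exists w : below a, A #<= segment w).
    exact: card_le_trans Aw (subset_card_le _).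
  case: nWA; apply: (wo_card_le (wo_below woK)) => w Aw.
  by apply: nA; exists w.
split => //; split.
- split=> [|w]; first exact: wo_below.
  split; first exact: subset_card_le.
  by move=> Ww; apply: nWA; exact: card_le_trans Ww (segwA w).
- by move=> finW; apply: infA; exact: card_le_finite AW finW.
- move=> C cofC [CW nWC]; apply: nWA.
  (* By [dich] a smaller cofinal set would embed in [A], making [below a] a union of at most |A|
     sets of size at most |A|. *)
  apply: (cofinal_card_le infA AA cofC) => //.
  by apply: contrapT => /dich.
Qed.

(** * Counting formulas *)

Section FormulaCode.
Context (K : Type) (k0 : K) (pr : K * K -> K) (tag : nat * K -> K).
Context (pr_inj : injective pr) (tag_inj : injective tag).

(* Tags 0, 1, 2, 4, 7 identify the head constructor; tags 3, 6, 9 store the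
   codes of the immediate subformulas. *)
Fixpoint form_code (phi : form K) (n : nat) (z : K) : Prop :=
  match phi, n with
  | FEq x y, 0 => z = pr (x, y)
  | FRel x y, 1 => z = pr (x, y)
  | FNot _, 2 => True
  | FNot psi, 3 => exists m w, form_code psi m w /\ z = tag (m, w)
  | FConj _ _, 4 => True
  | FConj A _, 5 => A z
  | FConj _ F, 6 =>
      exists a m w, form_code (F a) m w /\ z = pr (a, tag (m, w))
  | FEx _ _, 7 => True
  | FEx X _, 8 => X z
  | FEx _ psi, 9 => exists m w, form_code psi m w /\ z = tag (m, w)
  | _, _ => False
  end.

(** Tag 6 runs over all indices, also those outside [A], so the family of a conjunction is recovered
    as a function and syntactic equality follows. *)
Lemma form_code_inj (phi psi : form K) :
  (forall n z, form_code phi n z <-> form_code psi n z) -> phi = psi.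
Proof.
have sub (f g : form K) : (forall z,
    (exists m w, form_code f m w /\ z = tag (m, w)) <->
    (exists m w, form_code g m w /\ z = tag (m, w))) ->
    forall n z, form_code f n z <-> form_code g n z.
  move=> E n z; split=> c.
    have [|m [w [c' /tag_inj[-> ->]]] //] := (E (tag (n, z))).1.
    by exists n, z.
  have [|m [w [c' /tag_inj[-> ->]]] //] := (E (tag (n, z))).2.
  by exists n, z.
elim: phi psi => [x y|x y|phi IH|A F IH|X phi IH] psi E.
- have := (E 0 (pr (x, y))).1 erefl.
  by case: psi E => //= x' y' _ /pr_inj[-> ->].
- have := (E 1 (pr (x, y))).1 erefl.
  by case: psi E => //= x' y' _ /pr_inj[-> ->].
- have := (E 2 (pr (k0, k0))).1 I; case: psi E => //= psi E _.
  by congr FNot; apply/IH/sub => z; exact: (E 3 z).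
- have := (E 4 (pr (k0, k0))).1 I; case: psi E => //= B G E _.
  congr FConj; first by apply/seteqP; split=> z /(E 5 z).
  apply/funext => a; apply: IH => n z; split=> c.
    have [|a' [m [w [c' /pr_inj[-> /tag_inj[-> ->]]]]] //] :=
      (E 6 (pr (a, tag (n, z)))).1.
    by exists a, n, z.
  have [|a' [m [w [c' /pr_inj[-> /tag_inj[-> ->]]]]] //] :=
    (E 6 (pr (a, tag (n, z)))).2.
  by exists a, n, z.
- have := (E 7 (pr (k0, k0))).1 I; case: psi E => //= Y psi E _.
  congr FEx; first by apply/seteqP; split=> z /(E 8 z).
  by apply/IH/sub => z; exact: (E 9 z).
Qed.

End FormulaCode.

Lemma card_form_le (K : Type) : infinite_set [set: K] ->
  [set: K] `*` [set: K] #<= [set: K] -> [set: form K] #<= [set: set K].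
Proof.
move=> infK KK; have [k0 _] := infinite_setN0 infK.
have [pr [_ prI]] := card_le_fun k0 KK.
have /infiniteP/(card_le_fun k0)[t [_ tI]] := infK.
have pr_inj : injective pr by move=> x y; apply: prI.
have tag_inj : injective (fun q : nat * K => pr (t q.1, q.2)).
  by move=> [n x] [m y] /pr_inj /= [/tI -> // ->].
pose tag (q : nat * K) := pr (t q.1, q.2).
apply: (@card_le_rel _ _ _ _ (fun phi C => C = [set z |
  exists n w, form_code pr tag phi n w /\ z = tag (n, w)])).
  by move=> phi _; eexists.
move=> phi psi C _ _ -> /seteqP[sub1 sub2].
apply: (form_code_inj k0 pr_inj tag_inj) => n z; split=> c.
  have [|m [w [c' /tag_inj[-> ->]]] //] := sub1 (tag (n, z)).
  by exists n, z.
have [|m [w [c' /tag_inj[-> ->]]] //] := sub2 (tag (n, z)).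
by exists n, z.
Qed.

(** Only the number of formulas matters, so satisfaction is kept abstract as [Mods]. *)
Lemma not_all_definable (K I : Type) (M : Type) (U : set I -> set M)
    (Mods : form K -> set M) :
  infinite_set [set: K] -> [set: K] `*` [set: K] #<= [set: K] ->
  card_lt [set: set K] [set: set I] -> injective U ->
  exists S, forall phi, U S <> Mods phi.
Proof.
move=> infK KK [_ nle] U_inj; apply: contrapT => allS; apply: nle.
apply: card_le_trans (card_form_le infK KK).
apply: (@card_le_rel _ _ _ _ (fun S phi => U S = Mods phi)).
  move=> S _; apply: contrapT => noS; apply: allS; exists S => phi E.
  by apply: noS; exists phi.
by move=> S S' phi _ _ E E'; apply: U_inj; rewrite E E'.
Qed.

(** * Open classes of structures embedding a good part *)

Lemma open_of_bounded d (K : orderType d) (U : set (Mod K)) :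
  (forall M, U M -> exists k, forall M' : Mod K,
     (forall i j, i < k -> j < k -> M' i j = M i j) -> U M') -> open U.
Proof.
move=> bddU.
have open_basic (k : K) s : open (basic_open (a := k) s).
  (* The topology comes from a sub-base: a union of one finite intersection with one factor. *)
  exists [set basic_open s]; last by rewrite bigcup_set1.
  move=> _ ->; exists [fset basic_open s]%fset.
    by move=> N /fset1P ->; apply/mem_set; exists k, s.
  by rewrite set_fset1 bigcap_set1.
pose W (k : K) (M : Mod K) : set (Mod K) :=
  basic_open (fun i j : segment k => M (val i) (val j)).
have -> : U = \bigcup_(kM in [set kM : K * Mod K | W kM.1 kM.2 `<=` U])
    W kM.1 kM.2.
  apply/seteqP; split=> [M UM|M [kM sub /sub //]].
  have [k kP] := bddU M UM; exists (k, M) => //= M' WM'; apply: kP => i j ik jk.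
  by have /= := WM' (SigSub (mem_set (ik : segment k i)))
    (SigSub (mem_set (jk : segment k j))).
by apply: bigcup_open => kM _; exact: open_basic.
Qed.

Section Embeddings.
Context d (K : orderType d) (I V : Type) (R : I -> V -> V -> bool).
Context (Good : set (set V)) (iota : V -> K) (v0 : V).
Hypothesis iota_inj : injective iota.
Hypothesis Good_full : Good [set: V].
Hypothesis Good_bounded : forall X (f : V -> K), Good X ->
  exists k, Good [set u | X u /\ f u < k].
Hypothesis Good_linked : forall X x, Good X ->
  Good [set u | X u /\ exists2 v, X v & R x u v || R x v u].
Hypothesis Good_rigid : forall X x y (f : V -> V), Good X ->
  (forall u v, X u -> X v -> f u = f v -> u = v) ->
  (forall u v, X u -> X v -> R y (f u) (f v) = R x u v) -> x = y.

Definition embeds (S : set I) : set (Mod K) := [set M | exists x X f,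
  [/\ S x, Good X, (forall u v : V, X u -> X v -> f u = f v -> u = v) &
      forall u v, X u -> X v -> M (f u) (f v) = R x u v]].

Lemma open_embeds S : open (embeds S).
Proof.
apply: open_of_bounded => M [x [X [f [Sx GX f_inj fR]]]].
have [k Gk] := Good_bounded f GX; exists k => M' MM'.
exists x, [set u | X u /\ f u < k], f; split => //.
  by move=> u v [Xu _] [Xv _]; exact: f_inj.
by move=> u v [Xu uk] [Xv vk]; rewrite MM'// fR.
Qed.

Lemma iso_closed_embeds S : iso_closed (embeds S).
Proof.
move=> M N [g /bij_inj g_inj gMN] [x [X [f [Sx GX f_inj fR]]]].
exists x, X, (g \o f); split => //= u v Xu Xv; last by rewrite gMN fR.
by move=> /g_inj; exact: f_inj.
Qed.

(** In the copy along [iota] of the structure of [y], points outside the range are isolated. Linked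
    points cannot be sent there, so on them the embedding pulls back to a map of [V], and
    [Good_rigid] applies. *)
Lemma embeds_inj : injective embeds.
Proof.
suff sub S S' : embeds S = embeds S' -> S `<=` S'.
  by move=> S S' E; apply/seteqP; split; exact: sub.
move=> E y Sy.
pose M : Mod K := fun i j =>
  `[< exists u v, [/\ i = iota u, j = iota v & R y u v] >].
have Miota u v : M (iota u) (iota v) = R y u v.
  apply/asboolP/idP => [[u' [v' [/iota_inj -> /iota_inj -> //]]]|Ruv].
  by exists u, v.
have : embeds S M by exists y, setT, iota; split => // u v _ _; exact: iota_inj.
rewrite E => -[x [X [f [S'x GX f_inj fR]]]].
have /choice[iotaV iotaVP] i : exists v, (exists u, i = iota u) -> i = iota v.
  have [[u iu]|no] := pselect (exists u, i = iota u); last by exists v0.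
  by exists u.
have fX u : [set u | X u /\ exists2 v, X v & R x u v || R x v u] u ->
    iota (iotaV (f u)) = f u.
  move=> [Xu [v Xv]]; rewrite -!fR // => Rf.
  apply/esym/iotaVP.
  by case/orP: Rf => /asboolP[u' [v' [fu fv _]]]; [exists u'|exists v'].
suff <- : x = y by [].
apply: (Good_rigid (f := iotaV \o f) (Good_linked x GX)) => u v Xu Xv /=.
  by move=> /(congr1 iota); rewrite !fX //; apply: f_inj; [case: Xu|case: Xv].
by rewrite -Miota !fX // fR //; [case: Xu|case: Xv].
Qed.

End Embeddings.

(** * Stationary sets and ladders *)

Section Ladders.
Context d (Th : orderType d) d' (W : orderType d').
Context (regTh : regular_cardinal Th) (regW : regular_cardinal W).
Context (ltTW : card_lt [set: Th] [set: W]).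

Lemma reg_bound_le (f : W -> W) (b : W) :
  exists z, forall x, x <= b -> f x < z.
Proof.
have [b' bb'] := reg_next regW b.
have [z zP] := reg_bound regW f (reg_segment regW b'); exists z => x xb.
by apply: zP; exact: le_lt_trans bb'.
Qed.

Lemma reg_bound_prod (f : W * Th -> W) (b : W) :
  exists z, forall v, v.1 <= b -> f v < z.
Proof.
have /choice[g gP] t : exists z, forall x, x <= b -> f (x, t) < z.
  exact: (reg_bound_le (fun x => f (x, t)) b).
have [z zP] := reg_bound regW g ltTW; exists z => -[x t] /= xb.
exact: lt_trans (gP t x xb) (zP t I).
Qed.

Definition closed_under (h : W -> W) (a : W) : Prop :=
  forall b, b < a -> h b < a.

(* Equivalent to meeting every closed unbounded subset of W. *)
Definition stationary (B : set W) : Prop :=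
  forall h b, exists a, [/\ B a, b < a & closed_under h a].

Lemma closed_under_max h h' a :
  closed_under (fun b => Order.max (h b) (h' b)) a ->
  closed_under h a /\ closed_under h' a.
Proof. by move=> cl; split=> b /cl; rewrite gt_max => /andP[]. Qed.

Lemma stationary_sub (A B : set W) : A `<=` B -> stationary A -> stationary B.
Proof.
by move=> AB sA h b; have [a [/AB Ba ba ca]] := sA h b; exists a.
Qed.

(** By regularity, fewer than |W| witnesses of nonstationarity are dominated by a single one. *)
Lemma stationary_bigcup I (P : set I) (F : I -> set W) : card_lt P [set: W] ->
  stationary (\bigcup_(i in P) F i) -> exists2 i, P i & stationary (F i).
Proof.
move=> ltP sF; apply: contrapT => nF.
have /choice[h hP] i : exists h : W -> W, exists b, P i ->
    forall a, F i a -> b < a -> ~ closed_under h a.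
  have [Pi|nPi] := pselect (P i); last first.
    by have [x0 _] := reg_inhabited regW; exists id, x0.
  have /existsNP[h /existsNP[b nb]] : ~ stationary (F i).
    by move=> sFi; apply: nF; exists i.
  by exists h, b => _ a Fa ba ca; apply: nb; exists a.
have {hP}/choice[b bP] := hP.
have [b0 b0P] := reg_bound regW b ltP.
have /choice[H HP] x : exists z, forall i, P i -> h i x < z.
  exact: reg_bound.
have [a [[i Pi Fa] ba ca]] := sF H b0.
apply: (bP i Pi a Fa); first exact: lt_trans (b0P i Pi) ba.
by move=> x /ca; apply: lt_trans; exact: HP.
Qed.

(** Fodor's lemma by a diagonal bound: if every fibre fails through [h g] and [b g], let [H x]
    dominate [b g] and [h g y] for all [g] and [y] up to [x]. A point [a] of [B] closed under [H]
    then contradicts the failure of its own fibre [f a]. *)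
Lemma pressing_down (B : set W) (f : W -> W) : stationary B ->
  (forall a, B a -> f a < a) -> exists g, stationary [set a | B a /\ f a = g].
Proof.
move=> sB fB; apply: contrapT => nf.
have /choice[h hP] g : exists h : W -> W, exists b,
    forall a, B a -> f a = g -> b < a -> ~ closed_under h a.
  have /existsNP[h /existsNP[b nb]] : ~ stationary [set a | B a /\ f a = g].
    by move=> sg; apply: nf; exists g.
  by exists h, b => a Ba fa ba ca; apply: nb; exists a.
have {hP}/choice[b bP] := hP.
have /choice[H HP] x : exists z, forall g y, g <= x -> y <= x ->
    h g y < z /\ b g < z.
  have /choice[h' h'P] g := reg_bound_le (h g) x.
  have [z zP] := reg_bound_le (fun g => Order.max (h' g) (b g)) x.
  exists z => g y gx yx; have := zP g gx; rewrite gt_max => /andP[h'z bz].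
  by split => //; exact: lt_trans (h'P _ _ yx) h'z.
have [x0 _] := reg_inhabited regW.
have [a [Ba _ ca]] := sB H x0.
have fa := fB a Ba; apply: (bP (f a) a Ba erefl).
  by apply: lt_trans (ca _ fa); have [] := HP (f a) _ _ (lexx _) (lexx _).
move=> y ya; have ma : Order.max (f a) y < a by rewrite gt_max fa.
by apply: lt_trans (ca _ ma); have [] := HP (Order.max (f a) y) (f a) y _ _;
  rewrite // le_max lexx ?orbT.
Qed.

Definition ladder (c : Th -> W) (a : W) : Prop :=
  [/\ {homo c : s t / s < t}, forall t, c t < a &
      forall b, b < a -> exists t, b <= c t].

(** For regular [Th] these are the points of cofinality [Th]. *)
Definition has_ladder : set W := [set a | exists c, ladder c a].

Lemma ladder_bound c a I (P : set I) (f : I -> W) : ladder c a ->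
  card_lt P [set: Th] -> (forall i, P i -> f i < a) ->
  exists2 b, b < a & forall i, P i -> f i < b.
Proof.
move=> [cmono ca cof] ltP fa.
have [t0 _] := reg_inhabited regTh.
have /choice[t tP] i : exists t, P i -> f i <= c t.
  have [/fa/cof[t ft]|nPi] := pselect (P i); last by exists t0.
  by exists t.
have [s sP] := reg_bound regTh t ltP; exists (c s) => // i Pi.
exact: le_lt_trans (tP i Pi) (cmono _ _ (sP i Pi)).
Qed.

(** A sequence of type [Th] whose terms exceed [H] of all earlier ones has a supremum closed under
    [h]; the supremum exists because |Th| < |W|. *)
Lemma stationary_has_ladder : stationary has_ladder.
Proof.
move=> h b0.
have /choice[H HP] := reg_bound_le h.
have woTh := reg_wo regTh.
have [c cP] := wf_recursion b0 (fun (_ : Th) A y => [/\ b0 < y,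
  forall x, A x -> x < y & forall x, A x -> H x < y]) (wo_wf woTh).
have {}cP t : [/\ b0 < c t, forall s, s < t -> c s < c t &
    forall s, s < t -> H (c s) < c t].
  have [|b0t lt1 lt2] := cP t; last first.
    by split => // s st; [apply: lt1|apply: lt2]; exists s.
  have ltt : card_lt (segment t) [set: W].
    exact: card_lt_trans_le (reg_segment regTh t) ltTW.1.
  have [y yP] := reg_bound regW
    (fun s => Order.max b0 (Order.max (c s) (H (c s)))) ltt.
  have [z bz] := reg_next regW b0.
  exists (Order.max y z); split=> [|_ [s st <-]|_ [s st <-]];
    rewrite lt_max ?bz ?orbT//.
    by have := yP s st; rewrite !gt_max => /and3P[_ ->].
  by have := yP s st; rewrite !gt_max => /and3P[_ _ ->].
have [a ca amin] := wo_min (reg_wo regW) (reg_bound regW c ltTW).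
have {}ca t : c t < a by exact: ca.
have cof b : b < a -> exists t, b <= c t.
  move=> ba; apply: contrapT => nt.
  suff : a <= b by rewrite leNgt ba.
  apply: amin => t _; rewrite ltNge; apply/negP => bt; apply: nt; by exists t.
have [t0 _] := reg_inhabited regTh.
exists a; split.
- exists c; split => // s t st; by have [_ + _] := cP t; apply.
- by apply: lt_trans (ca t0); have [] := cP t0.
- move=> b /cof[t bt]; apply: lt_trans (HP _ _ bt) _.
  have [s ts] := reg_next regTh t.
  by apply: lt_trans (ca s); have [_ _] := cP s; apply.
Qed.

(* Solovay's splitting of the ladder points. *)
Lemma stationary_fibers (c : W -> Th -> W) :
  (forall a, has_ladder a -> ladder (c a) a) ->
  exists t, forall b, exists2 g, b <= g &
    stationary [set a | has_ladder a /\ c a t = g].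
Proof.
move=> cP.
(* Otherwise some [b0] exceeds all the failing bounds; but each ladder point above [b0] has a rung
   at or above [b0], and one index [t] serves a stationary set of them. *)
have [t tP] : exists t, forall b,
    stationary [set a | has_ladder a /\ b <= c a t].
  apply: contrapT => nt.
  have /choice[b bP] t : exists b,
      ~ stationary [set a | has_ladder a /\ b <= c a t].
    apply: contrapT => nb; apply: nt; exists t => b.
    by apply: contrapT => nS; apply: nb; exists b.
  have [b0 b0P] := reg_bound regW b ltTW.
  have [|t _ /bP//] := @stationary_bigcup _ [set: Th]
    (fun t => [set a | has_ladder a /\ b t <= c a t]) ltTW _.
  apply: (@stationary_sub [set a | has_ladder a /\ b0 < a]).
    move=> a [ha b0a]; have [_ _ cof] := cP a ha.
    have [t b0t] := cof _ b0a; exists t => //; split => //.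
    exact: le_trans (ltW (b0P t I)) b0t.
  move=> h b1; have [a [ha]] := stationary_has_ladder h (Order.max b0 b1).
  by rewrite gt_max => /andP[b0a b1a] ca; exists a.
exists t => b.
have [|g sg] := @pressing_down _ (fun a => c a t) (tP b).
  by move=> a [/cP[_ + _] _]; apply.
exists g; last by apply: stationary_sub sg => a [[]].
have [x0 _] := reg_inhabited regW.
by have [a [[[_ ba] <-] _ _]] := sg id x0.
Qed.

(** The values with a stationary fibre are unbounded, hence |W| many. Each element of [L] gets its
    own fibre, and [T x] collects the fibres of the elements of [x]. *)
Lemma stationary_difference_family (L : Type) : [set: L] #<= [set: W] ->
  exists T : set L -> set W, forall x y, x <> y ->
    exists2 B, stationary B &
      forall a, B a -> has_ladder a /\ ~ (T x a <-> T y a).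
Proof.
move=> LW; have [x0 _] := reg_inhabited regW.
have /choice[c cP] a : exists c : Th -> W, has_ladder a -> ladder c a.
  by have [[c ca]|na] := pselect (has_ladder a); [exists c|exists (fun=> x0)].
have [t tP] := stationary_fibers cP.
pose G := [set g | stationary [set a | has_ladder a /\ c a t = g]].
have cofG : cofinal_in G by move=> b; have [g bg sg] := tP b; exists g.
have WG : [set: W] #<= G.
  apply: contrapT => nWG; case: regW => _ _ /(_ G cofG); apply; split => //.
  exact: subset_card_le.
have [g [gG gI]] := card_le_fun x0 (card_le_trans LW WG).
exists (fun x => [set a | exists2 i, x i & c a t = g i]) => x y nxy.
have [i ni] : exists i, ~ (x i <-> y i).
  apply: contrapT => ni; apply: nxy; apply/predeqP => i.
  by apply: contrapT => nxyi; apply: ni; exists i.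
exists [set a | has_ladder a /\ c a t = g i]; first exact: (gG i I).
move=> a [ha ca]; split => //.
have T_i z : (exists2 j, z j & c a t = g j) <-> z i.
  split=> [[j zj]|zi]; last by exists i.
  by rewrite ca => /(gI i j I I) ->.
by rewrite /= !T_i.
Qed.

End Ladders.

(** * Graphs built from ladders *)

Section LadderGraph.
Context d (Th : orderType d) d' (W : orderType d').
Context (regTh : regular_cardinal Th) (regW : regular_cardinal W).
Context (ltTW : card_lt [set: Th] [set: W]).
Context (c : W -> Th -> W) (cP : forall a, has_ladder Th a -> ladder (c a) a).
Context (col : set W -> W -> W -> Th -> Prop).

(* Downward edges draw the ladders; upward edges carry the information
   about T. *)
Definition ladder_graph (T : set W) (u v : W * Th) : bool :=
  `[< v.1 < u.1 /\ has_ladder Th u.1 /\ (exists t, v.1 = c u.1 t) \/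
      u.1 < v.1 /\ col T u.1 v.1 v.2 >].

Lemma ladder_graph_down T u v : v.1 < u.1 ->
  ladder_graph T u v <-> has_ladder Th u.1 /\ exists t, v.1 = c u.1 t.
Proof.
move=> vu; split=> [/asboolP[[_ //]|[uv _]]|hu]; last by apply/asboolP; left.
by have := lt_trans uv vu; rewrite ltxx.
Qed.

Lemma ladder_graph_up T u v : u.1 < v.1 ->
  ladder_graph T u v <-> col T u.1 v.1 v.2.
Proof.
move=> uv; split=> [/asboolP[[vu _]|[_ //]]|cuv]; last by apply/asboolP; right.
by have := lt_trans uv vu; rewrite ltxx.
Qed.

(** The second clause lets [color_next_rigid] choose large second coordinates; the third keeps the
    cofinally many rungs that [embedding_fixes_rich] uses. *)
Definition rich (X : set (W * Th)) : set W := [set a |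
  [/\ has_ladder Th a, forall t, exists2 s, t < s & X (a, s) &
      forall b, b < a -> exists t s, b <= c a t /\ X (c a t, s)]].

Lemma rich_linked X T : rich X `<=`
  rich [set u | X u /\
    exists2 v, X v & ladder_graph T u v || ladder_graph T v u].
Proof.
move=> a [ha Xa Xc]; have [_ ca _] := cP ha.
have edge t s s' : ladder_graph T (a, s) (c a t, s').
  by apply/ladder_graph_down => //=; split => //; exists t.
have [t0 _] := reg_inhabited regTh.
have [t1 [s1 [_ X1]]] := Xc _ (ca t0).
have [s2 _ X2] := Xa t0.
split => //.
  move=> t; have [s ts Xs] := Xa t; exists s => //; split => //.
  by exists (c a t1, s1) => //; rewrite edge.
move=> b /Xc[t [s [bt Xs]]]; exists t, s; split => //; split => //.
by exists (a, s2) => //; rewrite orbC edge.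
Qed.

Lemma rich_setT : rich setT = [set a | has_ladder Th a].
Proof.
apply/seteqP; split=> [a [//]|a ha]; split => //.
  by move=> t; have [s ts] := reg_next regTh t; exists s.
by move=> b ba; have [_ _ /(_ b ba)[t bt]] := cP ha; exists t, t.
Qed.

(* A point closed under [f] and its inverse cannot move: its ladder is mapped
   cofinally below it, whereas the ladder of a larger point meets it in a
   bounded set. *)
Lemma embedding_fixes_rich X T T' (f : W * Th -> W * Th) :
  (forall u v, X u -> X v -> f u = f v -> u = v) ->
  (forall u v, X u -> X v ->
     ladder_graph T' (f u) (f v) = ladder_graph T u v) ->
  exists h, forall a s, rich X a -> closed_under h a -> X (a, s) ->
    (f (a, s)).1 = a.
Proof.
move=> f_inj fR.
have /choice[h1 h1P] := reg_bound_prod regW ltTW (fun u => (f u).1).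
have [x0 _] := reg_inhabited regW.
have /choice[pre preP] v : exists x, forall u, X u -> f u = v -> u.1 = x.
  have [[u [Xu fu]]|nv] := pselect (exists u, X u /\ f u = v); last first.
    by exists x0 => u Xu fu; case: nv; exists u.
  by exists u.1 => u' Xu' fu'; rewrite (f_inj _ _ Xu' Xu) // fu fu'.
have /choice[h2 h2P] := reg_bound_prod regW ltTW pre.
have {}h2P x u : X u -> (f u).1 <= x -> u.1 < h2 x.
  by move=> Xu fux; rewrite (preP _ u Xu erefl); exact: h2P.
exists (fun b => Order.max (h1 b) (h2 b)) => a s [ha Xa Xc].
move=> /closed_under_max[c1 c2] Xas.
have [c_mono ca cof] := cP ha.
have [lt_fa|lt_af|//] := ltgtP (f (a, s)).1 a.
  by have := lt_trans (h2P _ _ Xas (lexx _)) (c2 _ lt_fa); rewrite ltxx.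
(* Closure keeps the images of rungs below [a], hence below the image of [(a, s)]: the edge stays
   downward, so a rung goes to a rung. *)
have down t s' : X (c a t, s') -> [/\ (f (c a t, s')).1 < a,
    has_ladder Th (f (a, s)).1 &
    exists t', (f (c a t, s')).1 = c (f (a, s)).1 t'].
  move=> Xt; have fta : (f (c a t, s')).1 < a.
    by apply: lt_trans (c1 _ (ca t)); exact: h1P.
  have : ladder_graph T (a, s) (c a t, s').
    by apply/ladder_graph_down => //=; split => //; exists t.
  by rewrite -(fR _ _ Xas Xt) => /(ladder_graph_down _ (lt_trans fta lt_af))[].
have [t0 _] := reg_inhabited regTh.
have [t1 [s1 [_ /down[_ hfa _]]]] := Xc _ (ca t0).
have [cf_mono _ cof_f] := cP hfa.
have [t2 at2] := cof_f _ lt_af.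
(* The ladder of the larger point passes [a] at some index, so its rungs below [a] are too few to be
   cofinal in [a]. *)
have small : card_lt [set t | c (f (a, s)).1 t < a] [set: Th].
  apply: card_le_lt_trans (reg_segment regTh t2).
  apply: subset_card_le => t /= ct.
  rewrite /segment /= ltNge; apply/negP => t2t; have := lt_le_trans ct at2.
  by rewrite ltNge (ltW_homo cf_mono).
have [b ba bP] := ladder_bound regTh (cP ha) small (fun t ct => ct).
(* A rung at or above [h2 b] whose image lies below [b] contradicts the choice of [h2]. *)
have [t [s' [bt Xt]]] := Xc _ (c2 _ ba).
have [fta _ [t' ft']] := down _ _ Xt.
have fb : (f (c a t, s')).1 < b by rewrite ft'; apply: bP; rewrite /= -ft'.
by have := lt_le_trans (h2P _ _ Xt (ltW fb)) bt; rewrite ltxx.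
Qed.

End LadderGraph.

(** * Criterion for an undefinable class *)

Lemma card_le_prod T U T' (A : set T') : [set: T] #<= A -> [set: U] #<= A ->
  A `*` A #<= A -> [set: T * U] #<= A.
Proof.
move=> TA UA AA; rewrite -setXTT.
exact: card_le_trans (card_le_X TA UA) AA.
Qed.

Lemma exists_undefinable_class d (K : orderType d) (L V : Type)
    (R : set L -> V -> V -> bool) (Good : set (set V)) (v0 : V) :
  infinite_set [set: K] -> [set: K] `*` [set: K] #<= [set: K] ->
  card_lt [set: set K] [set: set (set L)] ->
  [set: V] #<= [set: K] ->
  Good [set: V] ->
  (forall X (f : V -> K), Good X -> exists k, Good [set u | X u /\ f u < k]) ->
  (forall X x, Good X ->
    Good [set u | X u /\ exists2 v, X v & R x u v || R x v u]) ->
  (forall X x y (f : V -> V), Good X ->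
    (forall u v, X u -> X v -> f u = f v -> u = v) ->
    (forall u v, X u -> X v -> R y (f u) (f v) = R x u v) -> x = y) ->
  exists U : set (Mod K), [/\ open U, iso_closed U &
    forall phi : form K, is_sentence phi -> U <> models phi].
Proof.
move=> infK KK powLK VK full bounded linked rigid.
have [k0 _] := infinite_setN0 infK.
have [iota [_ iota_inj]] := card_le_fun k0 VK.
have inj : injective (@embeds _ K _ _ R Good).
  by apply: (@embeds_inj _ _ _ _ _ _ iota v0) => // u v; exact: iota_inj.
have [S SP] := not_all_definable (@models _ K) infK KK powLK inj.
exists (embeds R Good S); split => //.
  exact: open_embeds.
exact: iso_closed_embeds.
Qed.

(** * A rigid pattern on the natural numbers *)

Section CountablePattern.
Context (L : Type) (j : L -> nat) (j_inj : injective j).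

(* The relation between [i] and [i'] determines [i' - i] when it is 1; the
   loops at 0 and 1, the only consecutive ones, exclude shifts. *)
Definition nat_loop (x : set L) (n : nat) : Prop :=
  (n <= 1)%N \/ exists2 i, x i & n = ((j i).*2 + 3)%N.

Definition nat_pattern (x : set L) (m n : nat) : bool :=
  (m < n)%N || (m == n.+1) || ((m == n) && `[< nat_loop x n >]).

Lemma nat_pattern_rigid x y (f : nat -> nat) : injective f ->
  (forall m n, nat_pattern y (f m) (f n) = nat_pattern x m n) -> x = y.
Proof.
move=> f_inj fR.
have neq m n : m <> n -> f m <> f n by move=> mn /f_inj.
have f2 n : (f n < f n.+2)%N.
  have := fR n n.+2; have := fR n.+2 n; rewrite /nat_pattern.
  have := neq n n.+2; lia.
have f1 n : f n.+1 = (f n).+1 \/ f n = (f n.+1).+1.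
  have := fR n n.+1; have := fR n.+1 n; rewrite /nat_pattern.
  have := neq n n.+1; lia.
(* A descent from [n] to [n.+1] would leave [f n.+2] at most [f n]. *)
have fS n : f n.+1 = (f n).+1.
  by have := f2 n; case: (f1 n); case: (f1 n.+1); lia.
have loopE n : nat_loop y (f n) <-> nat_loop x n.
  have diag z m : nat_pattern z m m = `[< nat_loop z m >].
    by rewrite /nat_pattern ltnn eqxx (_ : (m == m.+1) = false) //; lia.
  by have /(congr1 is_true) := fR n n; rewrite !diag !asboolE => ->.
(* [f 0] and its successor both carry loops, and looped points above 1 are odd. *)
have f0 : f 0 = 0%N.
  have := (loopE 0).2 (or_introl isT); have := (loopE 1).2 (or_introl isT).
  rewrite fS => l1 l0.
  by case: l1 => [?|[i _ ?]]; case: l0 => [?|[i' _ ?]]; lia.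
have fE n : f n = n by elim: n => // n IH; rewrite fS IH.
apply/seteqP; split=> i.
  move=> xi; have := (loopE ((j i).*2 + 3)%N).2
    (or_intror (ex_intro2 _ _ i xi erefl)).
  rewrite fE => -[|[i' yi' E]]; first by lia.
  by have /j_inj -> : j i = j i' by lia.
move=> yi; have := (loopE ((j i).*2 + 3)%N).1.
rewrite fE => /(_ (or_intror (ex_intro2 _ _ i yi erefl))).
move=> -[|[i' xi' E]]; first by lia.
by have /j_inj -> : j i = j i' by lia.
Qed.

End CountablePattern.

(** * Recovering the index from an embedding *)

Section Rigidity.
Context d (Th : orderType d) d' (W : orderType d').
Context (regTh : regular_cardinal Th) (regW : regular_cardinal W).
Context (ltTW : card_lt [set: Th] [set: W]).
Context (c : W -> Th -> W) (cP : forall a, has_ladder Th a -> ladder (c a) a).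
Context (L : Type) (Tf : set L -> set W).
Hypothesis Tf_diff : forall x y, x <> y -> exists2 B, stationary B &
  forall a, B a -> has_ladder Th a /\ ~ (Tf x a <-> Tf y a).

Definition color_top (T : set W) (a b : W) (z : Th) : Prop := T b.

(** A closed ladder point [a] and a closed [b] in [B] above it keep their first coordinates, so one
    upward edge reads both [Tf x b] and [Tf y b]. *)
Lemma color_top_rigid X x y (f : W * Th -> W * Th) :
  (forall a, has_ladder Th a -> rich c X a) ->
  (forall u v, X u -> X v -> f u = f v -> u = v) ->
  (forall u v, X u -> X v -> ladder_graph c color_top (Tf y) (f u) (f v) =
     ladder_graph c color_top (Tf x) u v) -> x = y.
Proof.
move=> richX f_inj fR; apply: contrapT => /Tf_diff[B sB BP].
have [h hP] := embedding_fixes_rich regTh regW ltTW cP f_inj fR.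
have [x0 _] := reg_inhabited regW; have [t0 _] := reg_inhabited regTh.
have [a [ha _ ca]] := stationary_has_ladder regTh regW ltTW h x0.
have [b [Bb ab cb]] := sB h a; have [hb nxy] := BP b Bb.
have [_ /(_ t0)[s _ Xas] _] := richX a ha.
have [_ /(_ t0)[z _ Xbz] _] := richX b hb.
have fa := hP a s (richX a ha) ca Xas; have fb := hP b z (richX b hb) cb Xbz.
have ab' : (f (a, s)).1 < (f (b, z)).1 by rewrite fa fb.
have Ex : ladder_graph c color_top (Tf x) (a, s) (b, z) <-> Tf x b.
  exact: ladder_graph_up.
have Ey : ladder_graph c color_top (Tf y) (f (a, s)) (f (b, z)) <-> Tf y b.
  by rewrite ladder_graph_up // /color_top fb.
by apply: nxy; rewrite -Ex -Ey fR.
Qed.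

Context (e : W -> W -> Th).
Hypothesis e_inj : forall b x y, x < b -> y < b -> e b x = e b y -> x = y.

(* Membership in T of the least point above [a] among the fewer than |Th|
   points below [b] whose index is at most [z]. *)
Definition color_next (T : set W) (a b : W) (z : Th) : Prop :=
  exists x, [/\ T x, a < x, x < b, e b x <= z &
    forall y, a < y -> y < x -> ~ (e b y <= z)].

Lemma color_next_rigid X x y (f : W * Th -> W * Th) :
  stationary (rich c X) ->
  (forall u v, X u -> X v -> f u = f v -> u = v) ->
  (forall u v, X u -> X v -> ladder_graph c color_next (Tf y) (f u) (f v) =
     ladder_graph c color_next (Tf x) u v) -> x = y.
Proof.
move=> sX f_inj fR; apply: contrapT => /Tf_diff[B sB BP].
have [h hP] := embedding_fixes_rich regTh regW ltTW cP f_inj fR.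
have [x0 _] := reg_inhabited regW; have [t0 _] := reg_inhabited regTh.
have /choice[g gP] b : exists a, [/\ rich c X a, closed_under h a & b < a].
  by have [a [ra ba ca]] := sX h b; exists a.
(* [B] may miss the rich points, but closure under [g] puts rich points cofinally below [dl], and
   [g dl] is one above it. *)
have [dl [Bdl _ cdl]] := sB g x0; have [[cd cdP] nxy] := BP dl Bdl.
have [rb cb db] := gP dl; move: (g dl) rb cb db => b rb cb db.
have [_ Xb _] := rb.
have fb z : X (b, z) -> (f (b, z)).1 = b by exact: hP.
(* [f] is injective and keeps the fibre over [b], so by regularity only boundedly many [z] get a
   second coordinate below [e b dl]. *)
have [z [Xbz ez ez2]] : exists z,
    [/\ X (b, z), e b dl <= z & e b dl <= (f (b, z)).2].
  apply: contrapT => nz.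
  have /choice[pre preP] t : exists z', forall z,
      X (b, z) -> (f (b, z)).2 = t -> z = z'.
    have [[z [Xz ft]]|no] := pselect (exists z, X (b, z) /\ (f (b, z)).2 = t).
      exists z => z' Xz' ft'; suff [] : (b, z') = (b, z) by [].
      apply: f_inj => //.
      rewrite [LHS]surjective_pairing [RHS]surjective_pairing.
      by rewrite !fb // ft ft'.
    by exists t0 => z Xz ft; case: no; exists z.
  have [zb zbP] := reg_bound regTh pre (reg_segment regTh (e b dl)).
  have [z] := Xb (Order.max zb (e b dl)); rewrite gt_max => /andP[zbz ez] Xz.
  have fz : (f (b, z)).2 < e b dl.
    rewrite ltNge; apply/negP => efz; apply: nz.
    by exists z; split => //; exact: ltW.
  have := zbP _ fz; rewrite -(preP _ z Xz erefl) => zzb.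
  by have := lt_trans zzb zbz; rewrite ltxx.
pose zm := Order.max z (f (b, z)).2.
have small : card_lt [set w | w < dl /\ e b w <= zm] [set: Th].
  have [zn zmn] := reg_next regTh zm.
  apply: card_le_lt_trans (reg_segment regTh zn).
  apply: (@card_le_rel _ _ _ _ (fun w t => t = e b w)) => [w [wd ew]|].
    by exists (e b w) => //; exact: le_lt_trans zmn.
  by move=> w w' t [wd _] [wd' _] -> /e_inj; apply; exact: lt_trans db.
(* [dl] has cofinality [Th], so the points below it of index at most [zm] stay below some [eta]. *)
have [eta eta_d etaP] := ladder_bound regTh cdP small (fun w wP => wP.1).
have [ra ca eta_a] := gP eta; have ad := cdl _ eta_d.
move: (g eta) ra ca eta_a ad => a ra ca eta_a ad.
(* [dl] is the least point above [a] of index at most [z']; this covers both [z] and the second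
   coordinate of [f (b, z)]. *)
have colE T z' : e b dl <= z' -> z' <= zm -> color_next T a b z' <-> T dl.
  move=> ez' z'zm; have between w : a < w -> w < dl -> ~ (e b w <= z').
    move=> aw wd ew; have := etaP w (conj wd (le_trans ew z'zm)).
    by rewrite ltNge (ltW (lt_trans eta_a aw)).
  split=> [[w [Tw aw wb ew noy]]|Tdl]; last by exists dl; split.
  have [wd|dw|<- //] := ltgtP w dl; first by case: (between w).
  by case: (noy dl).
have [_ /(_ t0)[s _ Xas] _] := ra.
have fa := hP a s ra ca Xas.
have ab : a < b by exact: lt_trans db.
have ab' : (f (a, s)).1 < (f (b, z)).1 by rewrite fa fb.
have Ex : ladder_graph c color_next (Tf x) (a, s) (b, z) <-> Tf x dl.
  by rewrite ladder_graph_up // colE // le_max lexx.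
have Ey : ladder_graph c color_next (Tf y) (f (a, s)) (f (b, z)) <-> Tf y dl.
  by rewrite ladder_graph_up // fa fb // colE // le_max lexx orbT.
by apply: nxy; rewrite -Ex -Ey fR.
Qed.

(** The pieces increase with [k] and cover [X]. If all pieces failed a clause of richness at [a],
    the fewer than |Th| witnesses would have a common bound, against richness for [X]. So each rich
    point is rich for some piece, and [stationary_bigcup] fixes the piece. *)
Lemma rich_bounded dK (K : orderType dK) (C : set K) X (f : W * Th -> K) :
  cofinal_in C -> card_lt C [set: Th] -> (forall k : K, exists k', k < k') ->
  stationary (rich c X) ->
  exists k, stationary (rich c [set u | X u /\ f u < k]).
Proof.
move=> cofC ltC nextK sX.
pose Xk k := [set u | X u /\ f u < k].
have cofX u : X u -> exists2 k, C k & Xk k u.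
  move=> Xu; have [k' fk'] := nextK (f u); have [k Ck k'k] := cofC k'.
  by exists k => //; split => //; exact: lt_le_trans k'k.
have [||k _ sk] := @stationary_bigcup _ _ regW _ C (fun k => rich c (Xk k)).
- exact: card_lt_trans_le ltC ltTW.1.
- apply: stationary_sub sX => a [ha Xa Xc].
  have [t0 _] := reg_inhabited regTh; have [x0 _] := reg_inhabited regW.
  have [k1 Ck1 k1P] : exists2 k, C k & forall t, exists2 s, t < s & Xk k (a, s).
    apply: contrapT => nk.
    have /choice[t tP] k : exists t, C k -> forall s, t < s -> ~ Xk k (a, s).
      have [Ck|nCk] := pselect (C k); last by exists t0.
      have /existsNP[t tP] : ~ forall t, exists2 s, t < s & Xk k (a, s).
        by move=> kP; apply: nk; exists k.
      by exists t => _ s ts Xs; apply: tP; exists s.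
    have [t1 t1P] := reg_bound regTh t ltC.
    have [s ts Xs] := Xa t1; have [k Ck Xks] := cofX _ Xs.
    by apply: (tP k Ck s) => //; exact: lt_trans (t1P k Ck) ts.
  have [k2 Ck2 k2P] : exists2 k, C k & forall b, b < a ->
      exists t s, b <= c a t /\ Xk k (c a t, s).
    apply: contrapT => nk.
    have /choice[b bP] k : exists b, C k -> b < a /\
        forall t s, b <= c a t -> ~ Xk k (c a t, s).
      have [Ck|nCk] := pselect (C k); last by exists x0.
      have /existsNP[b /not_implyP[ba bP]] : ~ forall b, b < a ->
          exists t s, b <= c a t /\ Xk k (c a t, s).
        by move=> kP; apply: nk; exists k.
      by exists b => _; split => // t s bt Xs; apply: bP; exists t, s.
    have [b1 b1a b1P] :=
      ladder_bound regTh (cP ha) ltC (fun k Ck => (bP k Ck).1).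
    have [t [s [bt Xs]]] := Xc _ b1a; have [k Ck Xks] := cofX _ Xs.
    by apply: (bP k Ck).2 _ _ _ Xks; exact: le_trans (ltW (b1P k Ck)) bt.
  have Xk_le k k' u : k <= k' -> Xk k u -> Xk k' u.
    by move=> kk' [Xu fu]; split => //; exact: lt_le_trans kk'.
  exists (Order.max k1 k2); first by case: leP.
  split => //.
    move=> t; have [s ts Xs] := k1P t; exists s => //; apply: Xk_le Xs.
    by rewrite le_max lexx.
  move=> b /k2P[t [s [bt Xs]]]; exists t, s; split => //; apply: Xk_le Xs.
  by rewrite le_max lexx orbT.
- by exists k.
Qed.

End Rigidity.

(** * The cases by cofinality *)

Section Cases.
Context d d' (L : orderType d) (K : orderType d').
Context (cardL : is_cardinal L) (cardK : is_cardinal K).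
Context (infL : infinite_set [set: L]) (infK : infinite_set [set: K]).
Context (ltLK : card_lt [set: L] [set: K]).
Context (powLK : card_lt [set: set K] [set: set (set L)]).

(** A greatest [k] would make [K] equinumerous with the segment of [k]. *)
Lemma cardinal_next (k : K) : exists k', k < k'.
Proof.
apply: contrapT => nk.
have Kk : [set: K] `<=` k |` segment k.
  move=> x _; have [xk|kx|->] := ltgtP x k; [by right| |by left].
  by case: nk; exists x.
have infk : infinite_set (segment k).
  move=> fink; apply: infK; apply: sub_finite_set Kk _.
  by rewrite finite_setU; split.
apply: (cardK.2 k).2; apply: card_le_trans (subset_card_le Kk) _.
exact: infinite_card_leU1.
Qed.

Lemma exists_ladder_choice dT (Th : orderType dT) dW (W : orderType dW) :
  regular_cardinal W -> exists c : W -> Th -> W,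
    forall a, has_ladder Th a -> ladder (c a) a.
Proof.
move=> regW; have [x0 _] := reg_inhabited regW.
have /choice[c cP] a : exists c : Th -> W, has_ladder Th a -> ladder c a.
  have [[c ca]|na] := pselect (has_ladder Th a); first by exists c.
  by exists (fun=> x0).
by exists c.
Qed.

Let KK := card_square cardK.1 infK.
Let LL := card_square cardL.1 infL.

(* Ladders of type L^+ in L^{++}: a partition into at most |L| pieces leaves
   one piece rich. *)
Lemma undefinable_small_cofinality (C : set K) :
  cofinal_in C -> C #<= [set: L] ->
  exists U : set (Mod K), [/\ open U, iso_closed U &
    forall phi : form K, is_sentence phi -> U <> models phi].
Proof.
move=> cofC CL.
have [t [regTh ltLT _]] : exists t : K, [/\ regular_cardinal (below t),
    card_lt [set: L] [set: below t] &
    forall b, b < t -> segment b #<= [set: L]].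
  (* Otherwise all segments of [K] embed in [L], and then so does [K], since [C] is cofinal. *)
  apply: (successor_cardinal cardK.1 infL LL); apply: contrapT => nt.
  apply: ltLK.2; apply: (cofinal_card_le infL LL cofC CL) => b.
  by apply: contrapT => nb; apply: nt; exists b.
have infT := reg_infinite regTh.
have TT := card_square (reg_wo regTh) infT.
have ltCT : card_lt C [set: below t] by exact: card_le_lt_trans ltLT.
have [m [regW ltTW segT]] : exists m : K, [/\ regular_cardinal (below m),
    card_lt [set: below t] [set: below m] &
    forall b, b < m -> segment b #<= [set: below t]].
  (* Otherwise [K] embeds in [below t], hence in the proper segment of [t]. *)
  apply: (successor_cardinal cardK.1 infT TT); apply: contrapT => nm.
  apply: (cardK.2 t).2; apply: card_le_trans (card_below_le t).
  apply: (cofinal_card_le infT TT cofC ltCT.1) => b.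
  by apply: contrapT => nb; apply: nm; exists b.
have [t0 _] := reg_inhabited regTh; have [m0 _] := reg_inhabited regW.
have /choice[e e_inj] (b : below m) : exists e : below m -> below t,
    forall x y, x < b -> y < b -> e x = e y -> x = y.
  have sb := card_le_trans (card_segment_below b) (segT _ (valP b)).
  by have [e [_ eI]] := card_le_fun t0 sb; exists e.
have [c cP] := exists_ladder_choice (below t) regW.
have [Tf TfP] := stationary_difference_family regTh regW ltTW
  (card_le_trans ltLT.1 ltTW.1).
have belowK (a : K) : [set: below a] #<= [set: K].
  exact: card_le_trans (card_below_le a) (subset_card_le _).
apply: (@exists_undefinable_class _ K L _
  (fun x => ladder_graph c (color_next e) (Tf x))
  (fun X => stationary (rich c X)) (m0, t0) infK KK powLK).
- exact: card_le_prod (belowK m) (belowK t) KK.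
- by rewrite (rich_setT regTh cP); exact: stationary_has_ladder.
- move=> X f.
  exact: (rich_bounded regTh regW ltTW cP f cofC ltCT cardinal_next).
- by move=> X x; apply: stationary_sub; exact: rich_linked.
- move=> X x y f sX f_inj fR.
  exact: (color_next_rigid regTh regW ltTW cP TfP e_inj sX f_inj fR).
Qed.

Hypothesis bounded : forall A : set K, A #<= [set: L] ->
  exists k, forall i, A i -> i < k.

(** Countable ranges are bounded in [K], so only the full set has to count as good; each [n] is
    linked to [n.+1]. *)
Lemma undefinable_countable : [set: L] #<= [set: nat] ->
  exists U : set (Mod K), [/\ open U, iso_closed U &
    forall phi : form K, is_sentence phi -> U <> models phi].
Proof.
move=> /(card_le_fun 0)[j [_ j_inj]].
have {}j_inj : injective j by move=> x y; exact: j_inj.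
have natL : [set: nat] #<= [set: L] by exact/infiniteP.
apply: (@exists_undefinable_class _ K L nat (nat_pattern j)
  (fun X => X = setT) 0 infK KK powLK) => //.
- exact: card_le_trans natL ltLK.1.
- move=> _ f ->; have [|k kP] := bounded (A := range f).
    exact: card_le_trans (card_image_le _ _) natL.
  by exists k; apply/seteqP; split => // n _; split => //; apply: kP; exists n.
- move=> _ x ->; apply/seteqP; split => // n _; split => //.
  by exists n.+1 => //; rewrite /nat_pattern ltnSn.
- move=> _ x y f -> f_inj fR; apply: (@nat_pattern_rigid _ j j_inj x y f).
    by move=> u v; exact: f_inj.
  by move=> u v; exact: fR.
Qed.

(** A part is good if all ladder points are rich in it: this survives linking, and cutting removes
    nothing because a map from [L * nat] to [K] has bounded range. *)
Lemma undefinable_uncountable : is_regular L -> ~ ([set: L] #<= [set: nat]) ->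
  exists U : set (Mod K), [/\ open U, iso_closed U &
    forall phi : form K, is_sentence phi -> U <> models phi].
Proof.
move=> regL nLnat.
have regW : regular_cardinal L by [].
have natL : [set: nat] #<= [set: L] by exact/infiniteP.
have ltTW : card_lt [set: nat] [set: L] by [].
have [l0 _] := reg_inhabited regW.
have [c cP] := exists_ladder_choice nat regW.
have [Tf TfP] := stationary_difference_family regular_cardinal_nat regW ltTW
  (card_lexx _).
have VL : [set: L * nat] #<= [set: L] by exact: card_le_prod.
apply: (@exists_undefinable_class _ K L (L * nat)
  (fun x => ladder_graph c (@color_top _ _ _ _) (Tf x))
  (fun X => forall a, has_ladder nat a -> rich c X a) (l0, 0) infK KK powLK).
- exact: card_le_trans VL ltLK.1.
- by move=> a; rewrite (rich_setT regular_cardinal_nat cP).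
- move=> X f richX; have [|k kP] := bounded (A := range f).
    exact: card_le_trans (card_image_le _ _) VL.
  exists k => a /richX; suff -> : [set u | X u /\ f u < k] = X by [].
  by apply/seteqP; split=> [u []|u Xu] //; split => //; apply: kP; exists u.
- by move=> X x richX a /richX; exact: (rich_linked regular_cardinal_nat).
- move=> X x y f richX f_inj fR.
  exact: (color_top_rigid regular_cardinal_nat regW ltTW cP TfP richX f_inj fR).
Qed.

End Cases.

Theorem theorem4p4 (d d' : Order.disp_t) (L : orderType d) (K : orderType d')
    (cardL : is_cardinal L) (cardK : is_cardinal K)
    (infL : infinite_set [set: L]) (infK : infinite_set [set: K])
    (ltLK : card_lt [set: L] [set: K])
    (regL : is_regular L)
    (powLK : card_lt [set: set K] [set: set (set L)]) :
  exists U : set (Mod K),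
    [/\ open U, iso_closed U &
        forall phi : form K, is_sentence phi -> U <> models phi].
Proof.
have [[C [cofC CL]]|nC] :=
    pselect (exists C : set K, cofinal_in C /\ C #<= [set: L]).
  exact: (undefinable_small_cofinality cardL cardK infL infK ltLK powLK
    cofC CL).
have bounded (A : set K) : A #<= [set: L] -> exists k, forall i, A i -> i < k.
  move=> AL; have /existsNP[k kP] : ~ cofinal_in A.
    by move=> cofA; apply: nC; exists A.
  exists k => i Ai; rewrite ltNge; apply/negP => ki.
  by apply: kP; exists i.
have [Lnat|nLnat] := pselect ([set: L] #<= [set: nat]).
  exact: (undefinable_countable cardK infL infK ltLK powLK bounded).
exact: (undefinable_uncountable cardL cardK infL infK ltLK powLK bounded).
Qed.
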